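(* Let $f:\mathbb{R}^d\to\mathbb{R}$ be differentiable and $\zeta$-quasar convex with respect to some global minimizer $x_\star\in\mathcal{X}_f$, for some $\zeta\in(0,1]$. Then $f\in\mathcal{F}_{\mathbf{I}}^{\mathrm{BA}}(t)$ for every $t>0$.
   Context: A differentiable $f:\mathbb{R}^d\to\mathbb{R}$ is $\zeta$-quasar convex with respect to $x_\star\in\mathcal{X}_f$, where $\zeta\in(0,1]$, if $f(x)-f_\star\le\frac1\zeta\langle\nabla f(x),x-x_\star\rangle$ for all $x\in\mathbb{R}^d$, where $f_\star=\min f$. Let $\langle\cdot,\cdot\rangle$, $\|\cdot\|$ be the Euclidean inner product and norm and $\mathcal{B}(x,t)=\{z\in\mathbb{R}^d:\|z-x\|\le t\}$. For $f:\mathbb{R}^d\to\mathbb{R}\cup\{+\infty\}$, $\operatorname{dom} f=\{x: f(x)<+\infty\}$; $f$ is proper if $\operatorname{dom} f\ne\emptyset$ and closed if it is lower semicontinuous; $\mathcal{X}_f$ is the set of global minimizers of $f$; $\mathrm{brox}^t_f(x)=\arg\min_{z\in\mathcal{B}(x,t)}f(z)$ (a set); $\mathcal{X}_f+\mathcal{B}(0,t)$ is the Minkowski sum. The class $\mathcal{F}_{\mathbf{I}}^{\mathrm{BA}}(t)$ consists of all proper, closed $f:\mathbb{R}^d\to\mathbb{R}\cup\{+\infty\}$ such that both of the following hold. (A) There exists $x_\star\in\mathcal{X}_f$ such that for every $x\in\operatorname{dom} f\setminus(\mathcal{X}_f+\mathcal{B}(0,t))$ and every $u\in\mathrm{brox}^t_f(x)$,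 $\langle x-u,\,x_\star-u\rangle\le 0$. (B) For all $x\in\operatorname{dom} f$: if $\mathrm{brox}^t_f(x)=\{x\}$, then $x\in\mathcal{X}_f$. *)

(* Defs.v *)
From HB Require Import structures.
From mathcomp Require Import all_boot all_order all_algebra.
From mathcomp Require Import all_classical all_reals all_analysis.
Set Implicit Arguments.
Unset Strict Implicit.
Unset Printing Implicit Defensive.
Import Order.TTheory GRing.Theory Num.Theory.
Import numFieldNormedType.Exports.
Local Open Scope classical_set_scope.
Local Open Scope ring_scope.

(* R^d is 'rV[R]_d.  The norm `|_| of the library is the sup norm: it is used
   only for the topology and for differentiability, which do not depend on the
   choice of a norm, while balls are taken for the Euclidean norm [enorm]. *)

Definition dot (R : realType) (d : nat) (u v : 'rV[R]_d) : R :=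
  \sum_(i < d) u 0 i * v 0 i.

Definition enorm (R : realType) (d : nat) (u : 'rV[R]_d) : R :=
  Num.sqrt (dot u u).

Definition eball (R : realType) (d : nat) (x : 'rV[R]_d) (t : R) :
    set 'rV[R]_d :=
  [set z | enorm (z - x) <= t].

Definition msum (R : realType) (d : nat) (A B : set 'rV[R]_d) :
    set 'rV[R]_d :=
  [set a + b | a in A & b in B].

Definition gradient (R : realType) (d : nat) (f : 'rV[R]_d -> R)
    (x : 'rV[R]_d) : 'rV[R]_d :=
  \row_(i < d) 'D_(delta_mx 0 i) f x.

(* Codomain-generic: used for real-valued and for extended-valued functions. *)
Definition argmin (T : Type) (disp : Order.disp_t) (V : porderType disp)
    (A : set T) (f : T -> V) : set T :=
  [set z | A z /\ forall y, A y -> (f z <= f y)%O].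

Definition minimizers (T : Type) (disp : Order.disp_t) (V : porderType disp)
    (f : T -> V) : set T :=
  argmin setT f.

(* An infimum in general; it is min f as soon as f has a minimizer. *)
Definition minval (T : Type) (R : realType) (f : T -> R) : R := inf (range f).

Definition quasar_convex (R : realType) (d : nat) (zeta : R)
    (f : 'rV[R]_d -> R) (xs : 'rV[R]_d) : Prop :=
  forall x, f x - minval f <= zeta^-1 * dot (gradient f x) (x - xs).

Definition edom (T : Type) (R : realType) (f : T -> \bar R) : set T :=
  [set x | (f x < +oo)%E].

Definition brox (R : realType) (d : nat) (t : R) (f : 'rV[R]_d -> \bar R)
    (x : 'rV[R]_d) : set 'rV[R]_d :=
  argmin (eball x t) f.

(* \bar R also contains -oo, which [FBA_no_ninfty] excludes. *)
Record FBA (R : realType) (d : nat) (t : R) (f : 'rV[R]_d -> \bar R) : Prop :=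
  { FBA_no_ninfty : forall x, f x != -oo%E;
    FBA_proper : edom f !=set0;
    FBA_closed : lower_semicontinuous f;
    FBA_A : exists2 xs, minimizers f xs &
      forall x, (edom f `\` msum (minimizers f) (eball 0 t)) x ->
      forall u, brox t f x u -> dot (x - u) (xs - u) <= 0;
    FBA_B : forall x, edom f x -> brox t f x = [set x] -> minimizers f x }.

(* Main.v *)
Require Import Defs.
From HB Require Import structures.
From mathcomp Require Import all_boot all_order all_algebra.
From mathcomp Require Import all_classical all_reals all_analysis.
From mathcomp Require Import lra.
Set Implicit Arguments.
Unset Strict Implicit.
Unset Printing Implicit Defensive.
Import Order.TTheory GRing.Theory Num.Theory.
Import numFieldNormedType.Exports.
Local Open Scope classical_set_scope.
Local Open Scope ring_scope.

(** Fix a point [u] that does not minimize [f], and let [v] point from [u] to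
    the reference minimizer [xs]. Quasar convexity bounds the derivative of [f]
    at [u] along [- v] from below by [zeta * (f u - min f)], which is positive,
    so [f] strictly decreases along [u + s *: v] for all small [s > 0]
    ([quasar_convex_descent]). Consequently, a point [u] of a ball that
    minimizes [f] over the ball without being a global minimizer cannot have
    all the points [u + s *: v], for small [s > 0], in that ball
    ([argmin_feasible_direction_le]).

    Both conditions follow by exhibiting such a feasible segment. For (A), if
    [x - u] made an acute angle with [v], then moving from [u] along [v] would
    first bring the point closer to [x], hence keep it in the ball around [x]
    ([eball_inward]); and [u] is no global minimizer because [x] is at distance
    more than [t] from all of them. For (B), [u] is the centre of the ball, and
    every direction is feasible there ([eball_center]). *)

Section InnerProduct.
Variables (R : realType) (d : nat).
Implicit Types u v x : 'rV[R]_d.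

Lemma dot_ge0 u : 0 <= dot u u.
Proof. by apply: sumr_ge0 => i _; rewrite -expr2 sqr_ge0. Qed.

Lemma dotNr u v : dot u (- v) = - dot u v.
Proof. by rewrite /dot -sumrN; apply: eq_bigr => i _; rewrite mxE mulrN. Qed.

Lemma dotNN u : dot (- u) (- u) = dot u u.
Proof. by apply: eq_bigr => i _; rewrite !mxE mulrNN. Qed.

Lemma dotDZ u v (s : R) :
  dot (u + s *: v) (u + s *: v) = dot u u + s * (2 * dot u v + s * dot v v).
Proof.
rewrite /dot !mulr_sumr -big_split /= mulr_sumr -big_split /=.
by apply: eq_bigr => i _; rewrite !mxE; lra.
Qed.

Lemma eballE x (t : R) z : 0 <= t ->
  eball x t z <-> dot (z - x) (z - x) <= t ^+ 2.
Proof.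
move=> t0; rewrite /eball /enorm /=.
by rewrite -(ler_sqrt _ (sqr_ge0 t)) sqrtr_sqr ger0_norm.
Qed.

(** The squared distance from [x] to [u + s *: v] has negative derivative at
    [s = 0], so it stays below its value at [0] for small [s > 0]. *)
Lemma eball_inward x u v (t : R) : 0 <= t -> eball x t u -> 0 < dot (x - u) v ->
  \forall s \near 0^'+, eball x t (u + s *: v).
Proof.
move=> t0 /(eballE _ _ t0) xu acute.
have v1 : 0 < dot v v + 1 by rewrite ltr_wpDl ?dot_ge0.
near=> s; apply/(eballE _ _ t0).
have s0 : 0 < s by near: s; exact: nbhs_right_gt.
have : s < 2 * dot (x - u) v / (dot v v + 1).
  by near: s; apply: nbhs_right_lt; rewrite divr_gt0 ?mulr_gt0.
rewrite ltr_pdivlMr // => small.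
rewrite addrAC dotDZ; apply: le_trans xu.
rewrite gerDl pmulr_rle0 //.
have -> : dot (u - x) v = - dot (x - u) v.
  rewrite /dot -sumrN; apply: eq_bigr => i _.
  by rewrite !mxE -mulNr opprB.
lra.
Unshelve. all: by end_near. Qed.

Lemma eball_center x v (t : R) : 0 < t ->
  \forall s \near 0^'+, eball x t (x + s *: v).
Proof.
move=> t0.
have v1 : 0 < dot v v + 1 by rewrite ltr_wpDl ?dot_ge0.
near=> s; apply/(eballE _ _ (ltW t0)).
have s0 : 0 < s by near: s; exact: nbhs_right_gt.
(* With [s < 1], the quadratic term is at most [s * dot v v]. *)
have s1 : s < 1 by near: s; exact: nbhs_right_lt.
have : s < t ^+ 2 / (dot v v + 1).
  by near: s; apply: nbhs_right_lt; rewrite divr_gt0 ?exprn_gt0.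
rewrite ltr_pdivlMr // => small.
have := dot_ge0 v.
rewrite addrAC subrr dotDZ; set z := dot 0 0; set w := dot 0 v.
have -> : z = 0 by rewrite /z /dot big1 // => i _; rewrite mxE mul0r.
have -> : w = 0 by rewrite /w /dot big1 // => i _; rewrite mxE mul0r.
move=> v0; nra.
Unshelve. all: by end_near. Qed.

End InnerProduct.

Section Derivative.
Variables (R : realType) (d : nat) (f : 'rV[R]_d -> R).

(** The differential is linear, so its value at [v] is read off the coordinates
    of [v] and the partial derivatives. *)
Lemma derive_gradient u v : differentiable f u ->
  'D_v f u = dot (gradient f u) v.
Proof.
move=> df; rewrite deriveE // {1}(row_sum_delta v) linear_sum /=.
by apply: eq_bigr => i _; rewrite linearZ /= mxE deriveE // mulrC.
Qed.

(** The difference quotients at [u] are eventually negative since their limit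
    is. *)
Lemma descent_direction u v : derivable f u v -> 'D_v f u < 0 ->
  \forall s \near 0^'+, f (u + s *: v) < f u.
Proof.
move=> /cvg_dnbhs_at_right quot neg; near=> s.
have s0 : 0 < s by near: s; exact: nbhs_right_gt.
have : s^-1 *: (f (s *: v + u) - f u) < 0.
  by near: s; exact: cvgr_lt quot _ neg.
by rewrite /GRing.scale /= pmulr_rlt0 ?invr_gt0 // subr_lt0 addrC.
Unshelve. all: by end_near. Qed.

Lemma minval_minimizer xs : minimizers f xs -> minval f = f xs.
Proof.
move=> [_ fmin]; apply/eqP; rewrite eq_le; apply/andP; split.
  apply: ge_inf; last by exists xs.
  by exists (f xs) => _ [y _ <-]; exact: fmin.
apply: lb_le_inf; first by exists (f xs), xs.
by move=> _ [y _ <-]; exact: fmin.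
Qed.

Lemma continuous_lower_semicontinuous :
  continuous f -> lower_semicontinuous (fun x => (f x)%:E).
Proof.
move=> cf x a; rewrite lte_fin => afx.
exists [set y | a < f y]; last by move=> y; rewrite lte_fin.
exact: cvgr_gt (cf x) _ afx.
Qed.

End Derivative.

Section QuasarConvex.
Variables (R : realType) (d : nat) (f : 'rV[R]_d -> R) (zeta : R).
Variable xs : 'rV[R]_d.
Hypotheses (f_diff : forall x, differentiable f x) (zeta_gt0 : 0 < zeta).
Hypotheses (xs_min : minimizers f xs) (f_qc : quasar_convex zeta f xs).

Lemma quasar_convex_descent u : f xs < f u ->
  \forall s \near 0^'+, f (u + s *: (xs - u)) < f u.
Proof.
move=> fu; apply: descent_direction; first exact: diff_derivable.
rewrite derive_gradient // -opprB dotNr oppr_lt0.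
have := f_qc u; rewrite (minval_minimizer xs_min) => qc.
rewrite -(pmulr_rgt0 _ (x := zeta^-1)) ?invr_gt0 //.
by rewrite (lt_le_trans _ qc) // subr_gt0.
Qed.

(** If the segment issued from [u] towards [xs] starts inside [A], its points
    compete with [u] for the minimum on [A], and the descent along it would
    contradict the minimality of [u] unless [f u <= f xs]. *)
Lemma argmin_feasible_direction_le (A : set 'rV[R]_d) u :
  argmin A (fun x => (f x)%:E) u ->
  (\forall s \near 0^'+, A (u + s *: (xs - u))) -> f u <= f xs.
Proof.
move=> [_ umin] feasible; rewrite leNgt; apply/negP => /quasar_convex_descent.
move=> /(filterI feasible) /filter_ex[s [/umin]].
by rewrite lee_fin => /le_lt_trans /[apply]; rewrite ltxx.
Qed.

Lemma minimizers_EFin u : f u <= f xs -> minimizers (fun x => (f x)%:E) u.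
Proof.
move=> uxs; split=> // y _; rewrite lee_fin; apply: le_trans uxs _.
exact: xs_min.2.
Qed.

End QuasarConvex.

Theorem theorem5p3 (R : realType) (d : nat) (f : 'rV[R]_d -> R) (zeta : R)
    (xs : 'rV[R]_d)
    (f_diff : forall x, differentiable f x)
    (zeta_gt0 : 0 < zeta) (zeta_le1 : zeta <= 1)
    (xs_min : minimizers f xs)
    (f_qc : quasar_convex zeta f xs)
    (t : R) (t_gt0 : 0 < t) :
  FBA t (fun x => (f x)%:E).
Proof.
split.
- by [].
- by exists xs; rewrite /edom /= ltry.
- apply: continuous_lower_semicontinuous => x.
  exact: differentiable_continuous.
- exists xs; first exact: (minimizers_EFin xs_min).
  move=> x [_ xfar] u ux; rewrite leNgt; apply/negP => acute; apply: xfar.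
  have umin : minimizers (fun x => (f x)%:E) u.
    apply: (minimizers_EFin xs_min).
    apply: (argmin_feasible_direction_le f_diff zeta_gt0 xs_min f_qc ux).
    exact: eball_inward (ltW t_gt0) ux.1 acute.
  exists u => //; exists (x - u); last by rewrite addrC subrK.
  by case: ux => + _; rewrite /eball /enorm /= subr0 -dotNN opprB.
- move=> x _ broxE; apply: (minimizers_EFin xs_min).
  have xx : brox t (fun x => (f x)%:E) x x by rewrite broxE.
  apply: (argmin_feasible_direction_le f_diff zeta_gt0 xs_min f_qc xx).
  exact: eball_center.
Qed.
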